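(* Let $p$ be an odd prime and $G$ the non-abelian group of order $p^3$ and exponent $p$. Let $S$ be a sequence over $G$ of length $3p-2$ such that at least $p-2$ terms of $S$ (counted with multiplicity) lie in $Z(G)$. Then $S$ has a non-empty product-one subsequence.
   Context: $G = \langle x, y : x^p = y^p = 1,\ [y,x] \text{ central}\rangle$ is the Heisenberg group of order $p^3$ and exponent $p$, with $Z(G)=[G,G]$ of order $p$. A sequence over $G$ is a finite unordered list (multiset) of elements of $G$; a subsequence is a sub-multiset; a non-empty sequence is product-one if some ordering of its terms has product $1$. *)

(* Defs.v *)
From mathcomp Require Import all_boot all_fingroup all_solvable.
Set Implicit Arguments. Unset Strict Implicit. Unset Printing Implicit Defensive.

Local Open Scope group_scope.

(* A (finite, unordered) sequence over G is represented by a list; all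
   notions below are invariant under permutation of the list. *)

Definition product_one (gT : finGroupType) (T : seq gT) : Prop :=
  T <> [::] /\ exists T' : seq gT, perm_eq T T' /\ \prod_(x <- T') x = 1.

Definition has_product_one_subseq (gT : finGroupType) (S : seq gT) : Prop :=
  exists m : bitseq, product_one (mask m S).

(* Main.v *)
Require Import Defs.
From mathcomp Require Import all_boot all_fingroup all_solvable all_algebra.
From mathcomp Require Import ring zify.
Import GRing.Theory.
Set Implicit Arguments. Unset Strict Implicit. Unset Printing Implicit Defensive.
(** Let [C] be the central and [T] the noncentral terms. The subset products of
    [C] number at least [min (p, |C| + 1)], so if [|C| >= p - 1] it suffices that
    [2p - 1] elements of [G] have a non-empty subsequence with product in [Z(G)].
    If [|C| = p - 2], the subset products of [C] miss at most one central element,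
    so, unless we are done, all non-empty subsequences of [T] with central product
    have the same product [w <> 1], in any order. Hence the terms of such a
    subsequence commute pairwise, and no two of them are disjoint.
    For [a] noncentral put [H = C_G(a)], which is abelian of order [p^2]. If more
    than [p] terms of [T] lie in [H], then [C] and these terms are at least [2p - 1]
    elements of [H = C_p x C_p] and a product-one subsequence exists. Otherwise the
    polynomial method applied to the terms outside [H], with the subset sums of the
    terms in [H] as allowed values, gives a subsequence with central product that has
    a term outside [H]. Using this for some [a], and then for a term [b] of the
    subsequence found, yields two disjoint subsequences, a contradiction. *)

(** * Polynomial functions on a group, via difference operators *)

Section PolynomialFunctions.
Local Open Scope group_scope.

Variables (gT : finGroupType) (G : {group gT}) (F : fieldType).
Implicit Types f g : gT -> F.

(* [f] is killed by any [n] successive difference operators, i.e. is a polynomial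
   function of degree less than [n]. *)
Fixpoint deg_lt (n : nat) (f : gT -> F) : Prop :=
  if n is n'.+1 then
    forall a, a \in G -> deg_lt n' (fun v => (f v - f (a * v)%g)%R)
  else forall v, v \in G -> f v = 0%R.

Lemma eq_deg_lt n f g : {in G, f =1 g} -> deg_lt n f -> deg_lt n g.
Proof.
elim: n f g => [|n IHn] f g fg /= df; first by move=> v Gv; rewrite -fg ?df.
by move=> a Ga; apply: IHn (df a Ga) => v Gv /=; rewrite !fg ?groupM.
Qed.

Lemma deg_lt0 n f : {in G, forall v, f v = 0%R} -> deg_lt n f.
Proof.
elim: n f => [|n IHn] f f0 //= a Ga; apply: IHn => v Gv.
by rewrite !f0 ?groupM // subr0.
Qed.

Lemma deg_ltW n f : deg_lt n f -> deg_lt n.+1 f.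
Proof.
elim: n f => [|n IHn] f df; first exact: deg_lt0.
by move=> a Ga; apply: IHn; apply: df.
Qed.

Lemma deg_ltD n f g :
  deg_lt n f -> deg_lt n g -> deg_lt n (fun v => (f v + g v)%R).
Proof.
elim: n f g => [|n IHn] f g df dg /=.
  by move=> v Gv; rewrite df ?dg ?addr0.
move=> a Ga; apply: eq_deg_lt (IHn _ _ (df a Ga) (dg a Ga)) => v _ /=.
by rewrite opprD addrACA.
Qed.

Lemma deg_ltN n f : deg_lt n f -> deg_lt n (fun v => (- f v)%R).
Proof.
elim: n f => [|n IHn] f df /=; first by move=> v Gv; rewrite df ?oppr0.
move=> a Ga; apply: eq_deg_lt (IHn _ (df a Ga)) => v _ /=.
by rewrite opprB opprK addrC.
Qed.

Lemma deg_lt_translate n f a :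
  a \in G -> deg_lt n.+1 f -> deg_lt n.+1 (fun v => f (a * v)).
Proof.
move=> Ga df; have dfa := deg_ltN (deg_ltW (df a Ga)).
by apply: eq_deg_lt (deg_ltD df dfa) => v _ /=; rewrite opprB addrC subrK.
Qed.

(** Leibniz rule: the difference of [f * g] is (difference of [f]) times [g], plus the translate of
    [f] times (difference of [g]). Degrees at most [m - 1] and [n - 1] add up to less than
    [m + n - 1], hence the predecessor. *)
Lemma deg_ltM m n f g :
  deg_lt m f -> deg_lt n g -> deg_lt (m + n).-1 (fun v => (f v * g v)%R).
Proof.
elim: m n f g => [|m IHm] n f g df.
  by move=> _; apply: deg_lt0 => v Gv; rewrite df ?mul0r.
elim: n f df g => [|n IHn] f df g dg.
  by apply: deg_lt0 => v Gv; rewrite dg ?mulr0.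
rewrite addSn addnS /= => a Ga.
have dl := IHm _ _ _ (df a Ga) dg.
have dr := IHn _ (deg_lt_translate Ga df) _ (dg a Ga).
rewrite addnS /= in dl; rewrite addSn /= in dr.
apply: eq_deg_lt (deg_ltD dl dr) => v _ /=.
by rewrite mulrBl mulrBr addrA subrK.
Qed.

Lemma deg_lt_prod_affine (chi : gT -> F) (r : seq F) :
    {in G &, forall x y, chi (x * y)%g = (chi x + chi y)%R} ->
  deg_lt (size r).+1 (fun v => (\prod_(c <- r) (chi v - c))%R).
Proof.
move=> chiD; elim: r => [|c r IHr] /=.
  by move=> a _ v _; rewrite !big_nil subrr.
have d2 : deg_lt 2 (fun v => (chi v - c)%R).
  by move=> a Ga b Gb v Gv /=; rewrite !chiD ?groupM //; ring.
apply: eq_deg_lt (deg_ltM d2 IHr) => v _.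
by rewrite big_cons.
Qed.

(** Differencing [f] along all terms of [s] and evaluating at [1] gives a signed sum of [f] over the
    subproducts of [s]. The degree bound makes it zero, so the term [f 1] cannot be the only
    non-zero one. *)
Lemma deg_lt_nonzero_subseq (s : seq gT) f :
    all (mem G) s -> deg_lt (size s) f -> f 1 != 0%R ->
  exists U : seq gT, [/\ subseq U s, U != [::] & f (\prod_(x <- U) x) != 0%R].
Proof.
elim: s f => [|a s IHs] f /=; first by move=> _ -> //; rewrite eqxx.
case/andP=> Ga Gs df f1.
have [fa0|fa] := eqVneq (f a) 0%R; last first.
  by exists [:: a]; rewrite big_seq1 fa /= eqxx sub0seq.
have [|U [Us Un fU]] := IHs _ Gs (df a Ga).
  by rewrite mulg1 fa0 subr0.
have [fU0|fUn] := eqVneq (f (\prod_(x <- U) x)) 0%R; last first.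
  by exists U; split=> //; apply: subseq_trans Us (subseq_cons _ _).
exists (a :: U); split; rewrite ?big_cons //=; first by rewrite eqxx.
by move: fU; rewrite fU0 sub0r oppr_eq0.
Qed.

End PolynomialFunctions.

(** * Additive maps to the prime field and their subset sums *)

Section AdditiveFunctions.
Local Open Scope group_scope.

Variables (gT : finGroupType) (p : nat).
Hypothesis p_pr : prime p.

Definition additive_on (K : {set gT}) (chi : gT -> 'F_p) :=
  {in K &, forall x y, chi (x * y)%g = (chi x + chi y)%R}.

Lemma additive_onS (H K : {set gT}) chi :
  H \subset K -> additive_on K chi -> additive_on H chi.
Proof. by move=> sHK chiD x y Hx Hy; apply: chiD; apply: (subsetP sHK). Qed.

Lemma additive_on1 (K : {group gT}) chi : additive_on K chi -> chi 1 = 0%R.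
Proof.
move=> chiD; have := chiD 1 1 (group1 K) (group1 K); rewrite mulg1.
by move/eqP; rewrite -{1}[chi 1]addr0 (inj_eq (addrI _)) eq_sym => /eqP.
Qed.

Lemma prod_in_group (K : {group gT}) (s : seq gT) :
  all (mem K) s -> \prod_(x <- s) x \in K.
Proof.
by move=> /allP Ks; rewrite big_seq; apply: group_prod => x /Ks.
Qed.

Lemma additive_on_prod (K : {group gT}) chi (s : seq gT) :
    additive_on K chi -> all (mem K) s ->
  chi (\prod_(x <- s) x) = (\sum_(x <- s) chi x)%R.
Proof.
move=> chiD; elim: s => [|x s IHs] /=; first by rewrite !big_nil (additive_on1 chiD).
by case/andP=> Kx Ks; rewrite !big_cons chiD ?prod_in_group ?IHs.
Qed.

(** The quotient [K / H] is cyclic of order [p]; [chi] is the discrete logarithm of the coset to a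
    generator, read modulo [p]. *)
Lemma index_prime_additive (K H : {group gT}) :
    H <| K -> #|K : H| = p ->
  exists2 chi, additive_on K chi & {in K, forall x, (chi x == 0%R) = (x \in H)}.
Proof.
move=> nsHK iHK; have nHK := normal_norm nsHK.
have oQ : #|K / H| = p by rewrite card_quotient.
have /cyclicP [y Qy] : cyclic (K / H) by apply: prime_cyclic; rewrite oQ.
have oy : #[y] = p by rewrite orderE -Qy.
have dlogP x : exists i : nat, (x \in K) ==> (coset H x == y ^+ i).
  case Kx: (x \in K); last by exists 0.
  have /cycleP [i ->] : coset H x \in <[y]> by rewrite -Qy mem_quotient.
  by exists i; rewrite eqxx.
pose d x := xchoose (dlogP x).
have dE x : x \in K -> coset H x = y ^+ d x.
  by move=> Kx; apply/eqP; apply: (implyP (xchooseP (dlogP x))).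
have eqF m n : ((m%:R : 'F_p) == n%:R)%R = (m == n %[mod p]).
  by rewrite -val_eqE /= !val_Fp_nat.
exists (fun x => (d x)%:R)%R => [x y' Kx Ky | x Kx] /=.
  apply/eqP; rewrite -natrD eqF -oy -eq_expg_mod_order expgD -!dE ?groupM //.
  by rewrite morphM ?(subsetP nHK).
rewrite -[0%R]/((0%:R : 'F_p)%R) eqF -oy -eq_expg_mod_order -dE // expg0.
apply/eqP/idP => [/coset_idr -> //|]; first exact: (subsetP nHK).
exact: coset_id.
Qed.

(* The product of the linear factors vanishing off [B1] and [B2] has too small a
   degree to be supported, among the subproducts of [s], at [1] only. *)
Lemma subseq_values_in (K : {group gT}) chi1 chi2 (B1 B2 : {set 'F_p}) (s : seq gT) :
    additive_on K chi1 -> additive_on K chi2 ->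
    0%R \in B1 -> 0%R \in B2 -> all (mem K) s ->
    #|~: B1| + #|~: B2| < size s ->
  exists U : seq gT, [/\ subseq U s, U != [::], chi1 (\prod_(x <- U) x) \in B1
              & chi2 (\prod_(x <- U) x) \in B2].
Proof.
move=> chi1D chi2D B10 B20 Ks lt_s.
pose P (chi : gT -> 'F_p) B v := (\prod_(c <- enum (~: B)) (chi v - c))%R.
have PP chi B v : (P chi B v != 0%R) = (chi v \in B).
  rewrite prodf_seq_neq0; apply/allP/idP => [nz | Bv c].
    apply: contraT => nBv; have := nz (chi v).
    by rewrite mem_enum inE subrr eqxx => /(_ nBv).
  by rewrite mem_enum inE subr_eq0; apply: contraNneq => <-.
have dP := deg_ltM (deg_lt_prod_affine (enum (~: B1)) chi1D)
  (deg_lt_prod_affine (enum (~: B2)) chi2D).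
have degW n m f : n <= m -> deg_lt K n f -> @deg_lt _ K 'F_p m f.
  by move=> /subnK <-; elim: (m - n) => // k IHk /IHk /deg_ltW.
(* The product of all linear factors has degree [#|~: B1| + #|~: B2|], so the strict inequality on
   [size s] is exactly what is needed. *)
have le_s : ((size (enum (~: B1))).+1 + (size (enum (~: B2))).+1).-1 <= size s.
  by rewrite -!cardE addSn addnS.
have [|U [Us Un]] := deg_lt_nonzero_subseq Ks (degW _ _ _ le_s dP).
  by rewrite mulf_eq0 negb_or !PP (additive_on1 chi1D) (additive_on1 chi2D) B10.
rewrite mulf_eq0 negb_or !PP => /andP [U1 U2].
by exists U.
Qed.

Fixpoint subset_sums (chi : gT -> 'F_p) (s : seq gT) : {set 'F_p} :=
  if s is x :: s' then
    let A := subset_sums chi s' in A :|: [set (chi x + a)%R | a in A]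
  else [set 0%R].

Lemma subset_sums0 chi s : 0%R \in subset_sums chi s.
Proof. by elim: s => [|x s IHs] /=; rewrite !inE // IHs. Qed.

Lemma subset_sumsP chi s a :
    a \in subset_sums chi s ->
  exists2 U, subseq U s & (\sum_(x <- U) chi x)%R = a.
Proof.
elim: s a => [|x s IHs] a /=.
  by rewrite inE => /eqP ->; exists [::]; rewrite ?big_nil.
rewrite inE => /orP [/IHs [U Us <-] | /imsetP [b /IHs [U Us <-] ->]].
  by exists U => //; apply: subseq_trans Us (subseq_cons _ _).
by exists (x :: U); rewrite /= ?eqxx // big_cons.
Qed.

Lemma translation_stable_Fp (A : {set 'F_p}) a b :
  b \in A -> a != 0%R -> (forall c, c \in A -> (a + c)%R \in A) -> A = setT.
Proof.
move=> Ab a0 Aa; apply/setP=> c; rewrite inE.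
have An n : (a *+ n + b)%R \in A.
  by elim: n => [|n IHn]; rewrite ?mulr0n ?add0r // mulrS -addrA Aa.
suff -> : c = (a *+ ((c - b) / a : 'F_p)%R + b)%R by apply: An.
by rewrite -mulr_natr natr_Zp mulrC divfK // subrK.
Qed.

(** A further non-zero term either enlarges the set of sums or leaves it stable under a non-zero
    translation; in the latter case the set is all of ['F_p]. *)
Lemma card_subset_sums chi s :
  all (fun x => chi x != 0%R) s -> minn p (size s).+1 <= #|subset_sums chi s|.
Proof.
elim: s => [|x s IHs] /=; first by rewrite cards1 geq_minr.
case/andP=> x0 /IHs; set A := subset_sums chi s => leA.
set B := [set _ | a in A].
have [sBA|nsBA] := boolP (B \subset A).
  rewrite (@translation_stable_Fp (A :|: B) (chi x) 0%R) //.
  - by rewrite cardsT card_Fp // geq_minl.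
  - by rewrite inE subset_sums0.
  move=> c; rewrite (setUidPl sBA) => Ac.
  by apply: (subsetP sBA); apply/imsetP; exists c.
have : #|A| < #|A :|: B|.
  apply: proper_card; rewrite properE subsetUl subUset subxx /=.
  exact: nsBA.
by move=> ltAB; apply: leq_trans ltAB; move: #|A| leA => c; lia.
Qed.

End AdditiveFunctions.

(** * Subsequences up to reordering *)

Section SubMultisets.
Local Open Scope group_scope.

Variables (gT : finGroupType).
Implicit Types U V s t : seq gT.

(** Only multiplicities are compared, so that a chosen subsequence may be reordered freely. *)
Definition submset U s := forall x, count_mem x U <= count_mem x s.

Lemma subseq_submset U s : subseq U s -> submset U s.
Proof. by move=> Us x; apply: leq_count_subseq. Qed.

Lemma submset_cat U V s t : submset U s -> submset V t -> submset (U ++ V) (s ++ t).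
Proof. by move=> Us Vt x; rewrite !count_cat leq_add. Qed.

Lemma submset_trans U V s : submset U V -> submset V s -> submset U s.
Proof. by move=> UV Vs x; apply: leq_trans (UV x) (Vs x). Qed.

Lemma perm_submset U s : perm_eq U s -> submset U s.
Proof. by move=> /seq.permP Us x; rewrite Us. Qed.

Lemma submset_mem U s x : submset U s -> x \in U -> x \in s.
Proof. by move=> Us; rewrite -!has_pred1 !has_count => /leq_trans ->. Qed.

Lemma submset_all (P : pred gT) U s : submset U s -> all P s -> all P U.
Proof. by move=> Us /allP Ps; apply/allP=> x /(submset_mem Us)/Ps. Qed.

Lemma submset_product_one U s :
    submset U s -> U != [::] -> \prod_(x <- U) x = 1 ->
  has_product_one_subseq s.
Proof.
move=> /count_subseqP [V /subseqP [m _ ->] pUV] Un U1.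
exists m; split; last by exists U; rewrite perm_sym.
by move=> m0; case/eqP: Un; apply/perm_nilP; rewrite -m0.
Qed.

Lemma has_product_one_subseq_submset s t :
  submset s t -> has_product_one_subseq s -> has_product_one_subseq t.
Proof.
move=> st [m [mn [U [pU U1]]]]; apply: (@submset_product_one U) => //.
  apply: submset_trans st; apply: submset_trans (subseq_submset (mask_subseq m s)).
  by apply: perm_submset; rewrite perm_sym.
by apply/eqP=> U0; apply: mn; apply/perm_nilP; rewrite -U0.
Qed.

End SubMultisets.

(** * Centralizers and coordinates in the Heisenberg group *)

Section HeisenbergGroup.
Local Open Scope group_scope.

Variables (gT : finGroupType) (G : {group gT}) (p : nat).
Hypotheses (p_pr : prime p) (oG : #|G| = (p ^ 3)%N) (nabG : ~~ abelian G).
Hypothesis expG : exponent G = p.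

Let pG : p.-group G.
Proof. by rewrite /pgroup oG pnatX pnat_id. Qed.

Let esG : extraspecial G.
Proof. by apply: p3group_extraspecial pG nabG _; rewrite oG pfactorK. Qed.

Lemma card_Heisenberg_center : #|'Z(G)| = p.
Proof. exact: card_center_extraspecial pG esG. Qed.

Lemma Heisenberg_noncentral : exists2 a, a \in G & a \notin 'Z(G).
Proof.
apply/subsetPn; apply: contra nabG => sGZ.
exact: abelianS sGZ (center_abelian G).
Qed.

Section Centralizers.

Variable a : gT.
Hypotheses (Ga : a \in G) (nZa : a \notin 'Z(G)).

Let maxC : maximal 'C_G[a] G.
Proof. exact: cent1_extraspecial_maximal. Qed.

Lemma normal_subcent1 : 'C_G[a] <| G.
Proof. exact: p_maximal_normal pG maxC. Qed.

Lemma index_subcent1 : #|G : 'C_G[a]| = p.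
Proof. exact: p_maximal_index pG maxC. Qed.

Lemma card_subcent1 : #|'C_G[a]| = (p ^ 2)%N.
Proof.
have := Lagrange (normal_sub normal_subcent1); rewrite index_subcent1 oG => /eqP.
by rewrite expnSr eqn_pmul2r ?prime_gt0 // => /eqP.
Qed.

Lemma abelian_subcent1 : abelian 'C_G[a].
Proof. exact: card_p2group_abelian p_pr card_subcent1. Qed.

Lemma center_sub_subcent1 : 'Z(G) \subset 'C_G[a].
Proof. by rewrite setIS // -cent_set1 centS ?sub1set. Qed.

Lemma mem_subcent1 : a \in 'C_G[a].
Proof. by rewrite inE Ga cent1id. Qed.

Lemma order_noncentral : #[a] = p.
Proof.
apply: nt_prime_order => //; first by rewrite -expG expg_exponent.
by apply: contraNneq nZa => ->; apply: group1.
Qed.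

Lemma center_TI_cycle : 'Z(G) :&: <[a]> = 1.
Proof.
rewrite setIC; apply: prime_TIg; first by rewrite -orderE order_noncentral.
by rewrite cycle_subG.
Qed.

End Centralizers.

(** As ['C_G[a]] is abelian and contains [x], it lies in ['C_G[x]], and both have order [p ^ 2]. *)
Lemma eq_subcent1 a x : a \in G -> a \notin 'Z(G) ->
  x \in 'C_G[a] -> x \notin 'Z(G) -> 'C_G[x] = 'C_G[a].
Proof.
move=> Ga nZa Cx nZx; have Gx : x \in G by case/setIP: Cx.
apply/esym/eqP; rewrite eqEcard !card_subcent1 // leqnn andbT subsetI subsetIl /=.
by rewrite sub_cent1 (subsetP (abelian_subcent1 Ga nZa)).
Qed.

(** A noncentral common element [x] would force both centralizers to equal ['C_G[x]], and [b] would
    lie in ['C_G[a]]. *)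
Lemma subcent1I_center a b : a \in G -> a \notin 'Z(G) ->
    b \in G -> b \notin 'C_G[a] ->
  'C_G[a] :&: 'C_G[b] \subset 'Z(G).
Proof.
move=> Ga nZa Gb nCb; apply/subsetP=> x /setIP [xa xb].
have nZb : b \notin 'Z(G) by apply: contra nCb; apply: (subsetP (center_sub_subcent1 Ga)).
apply: contraT => nZx; case/negP: nCb.
by rewrite -(eq_subcent1 Ga nZa xa nZx) (eq_subcent1 Gb nZb xb nZx) mem_subcent1.
Qed.

(** These are coordinates on the quotient of [G] by its center. The kernels are the centralizers of
    [a] and of some [b] not commuting with [a]; they meet in the center. *)
Lemma Heisenberg_coordinates a : a \in G -> a \notin 'Z(G) ->
  exists chi : (gT -> 'F_p) * (gT -> 'F_p),
  [/\ additive_on G chi.1, additive_on G chi.2,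
      {in G, forall x, (chi.1 x == 0%R) = (x \in 'C_G[a])}
    & {in G, forall x, (x \in 'Z(G)) = (chi.1 x == 0%R) && (chi.2 x == 0%R)}].
Proof.
move=> Ga nZa.
have [b Gb nCb] : exists2 b, b \in G & b \notin 'C_G[a].
  apply/subsetPn; rewrite subsetI subxx /=; apply: contra nZa => cGa.
  by rewrite inE Ga -sub_cent1.
have nZb : b \notin 'Z(G) by apply: contra nCb; apply: (subsetP (center_sub_subcent1 Ga)).
have [chi1 D1 k1] := index_prime_additive p_pr (normal_subcent1 Ga nZa) (index_subcent1 Ga nZa).
have [chi2 D2 k2] := index_prime_additive p_pr (normal_subcent1 Gb nZb) (index_subcent1 Gb nZb).
exists (chi1, chi2); split=> //= x Gx; rewrite k1 // k2 // -in_setI.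
apply/idP/idP; last exact: (subsetP (subcent1I_center Ga nZa Gb nCb)).
by apply: subsetP; rewrite subsetI !center_sub_subcent1.
Qed.

(** Both coordinates of a product are sums, hence independent of the order of the factors. *)
Lemma prod_center_perm s t : all (mem G) s -> perm_eq s t ->
  (\prod_(x <- s) x \in 'Z(G)) = (\prod_(x <- t) x \in 'Z(G)).
Proof.
move=> Gs pst; have Gt : all (mem G) t by rewrite -(perm_all _ pst).
have [a Ga nZa] := Heisenberg_noncentral.
have [chi [D1 D2 _ kZ]] := Heisenberg_coordinates Ga nZa.
rewrite !kZ ?prod_in_group // !(additive_on_prod D1, additive_on_prod D2) //.
by rewrite !(perm_big t pst).
Qed.

Lemma center_additive :
  exists2 chi : gT -> 'F_p, additive_on 'Z(G) chi
    & {in 'Z(G), forall x, (chi x == 0%R) = (x == 1)}.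
Proof.
have [||chi D k] := @index_prime_additive _ p p_pr 'Z(G)%G 1%G.
- exact: normal1.
- by rewrite indexg1 card_Heisenberg_center.
by exists chi => // x Zx; rewrite k // inE.
Qed.

(** * Completing subsequences with central product by central terms *)

Section CentralAndNoncentralTerms.

Variables C T : seq gT.
Hypotheses (ZC : all (mem 'Z(G)) C) (C1 : 1 \notin C) (GT : all (mem G) T).

Definition central_sub V :=
  [/\ submset V T, V != [::] & \prod_(x <- V) x \in 'Z(G)].

Lemma card_central_subset_sums (chi : gT -> 'F_p) :
    {in 'Z(G), forall x, (chi x == 0%R) = (x == 1)} ->
  minn p (size C).+1 <= #|subset_sums chi C|.
Proof.
move=> kZ; apply: (card_subset_sums p_pr); apply/allP=> x Cx.
have Zx : x \in 'Z(G) := allP ZC _ Cx.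
by rewrite kZ //; apply: contraNneq C1 => <-.
Qed.

Lemma central_sub_completion (chi : gT -> 'F_p) V :
    additive_on 'Z(G) chi -> {in 'Z(G), forall x, (chi x == 0%R) = (x == 1)} ->
    central_sub V -> (- chi (\prod_(x <- V) x)%g)%R \in subset_sums chi C ->
  has_product_one_subseq (C ++ T).
Proof.
move=> D k [VT Vn VZ] /subset_sumsP [U /subseq_submset UC sU].
have ZU := submset_all UC ZC.
apply: (@submset_product_one _ (U ++ V)); first exact: submset_cat.
  by rewrite -nilpE /nilp size_cat addn_eq0 negb_and orbC size_eq0 Vn.
rewrite big_cat /=; apply/eqP; rewrite -k ?groupM ?(prod_in_group ZU) //.
by rewrite D ?(prod_in_group ZU) // (additive_on_prod D ZU) sU addNr.
Qed.

Lemma product_one_of_many_central :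
    p.-1 <= size C -> 2 * p - 1 <= size T ->
  has_product_one_subseq (C ++ T).
Proof.
move=> leC leT; have p_gt1 := prime_gt1 p_pr.
have [chi D k] := center_additive.
have [a Ga nZa] := Heisenberg_noncentral.
have [[chi1 chi2] [/= D1 D2 _ kZ]] := Heisenberg_coordinates Ga nZa.
have cC0 : #|~: [set 0%R : 'F_p]| = p.-1.
  by rewrite cardsC1 card_Fp.
have [||||U [UT Un]] := @subseq_values_in _ p G _ _ [set 0%R] [set 0%R] T D1 D2.
- by rewrite inE.
- by rewrite inE.
- by [].
(* The two complements cost [2 * p - 2], one less than the number of terms available. *)
- by rewrite cC0; clear - leT p_gt1; lia.
rewrite !inE => U1 U2; apply: (@central_sub_completion chi U) => //.
  split=> //; first exact: subseq_submset.
  rewrite kZ ?U1 ?U2 // prod_in_group //.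
  exact: submset_all (subseq_submset UT) GT.
suff -> : subset_sums chi C = setT by rewrite inE.
apply/eqP; rewrite eqEcard subsetT cardsT card_Fp //.
by apply: leq_trans (card_central_subset_sums k); clear - leC p_gt1; lia.
Qed.

Hypothesis nZT : all (fun x => x \notin 'Z(G)) T.
Hypotheses (sC : size C = p - 2) (sT : size T = (2 * p)%N).

(** The alternatives depend on whether at most [p] terms of [T] commute with [a]. If so, these terms
    only help to adjust the second coordinate; if not, the abelian group ['C_G[a]] already contains
    enough terms. *)
Lemma central_sub_off_subcent1 a : a \in G -> a \notin 'Z(G) ->
  has_product_one_subseq (C ++ T) \/
  exists V, central_sub V /\ exists2 x, x \in V & x \notin 'C_G[a].
Proof.
move=> Ga nZa; have p_gt1 := prime_gt1 p_pr.
have [[chi1 chi2] [/= D1 D2 k1 kZ]] := Heisenberg_coordinates Ga nZa.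
have C0 : #|~: [set 0%R : 'F_p]| = p.-1 by rewrite cardsC1 card_Fp.
have F0 : (0%R : 'F_p) \in [set 0%R] by rewrite inE.
pose H := [group of 'C_G[a]].
have sHG : H \subset G by apply: subsetIl.
pose TH : seq gT := filter (mem H) T; pose TN : seq gT := filter (predC (mem H)) T.
have pT : submset (TH ++ TN) T by apply: perm_submset; rewrite /TH /TN perm_filterC.
have sTHN : size TH + size TN = (2 * p)%N by rewrite -sT !size_filter count_predC.
have HTH : all (mem H) TH by apply: filter_all.
have [le_p|gt_p] := leqP (size TH) p; [right | left].
  have THG : all (mem G) TH by apply/allP=> x /(allP HTH)/(subsetP sHG).
  have TNG : all (mem G) TN.
    by apply/allP=> x; rewrite mem_filter => /andP [_ /(allP GT)].
  have nz2 : all (fun x => chi2 x != 0%R) TH.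
    apply/allP=> x xTH; have Gx := allP THG _ xTH.
    have: x \in T by move: xTH; rewrite mem_filter => /andP [].
    move/(allP nZT); rewrite kZ //; apply: contra => ->; rewrite andbT k1 //.
    exact: (allP HTH).
  (* These are the second coordinates that terms of [TH] can cancel. Those terms have first
     coordinate zero, so [TN] alone must make the first coordinate vanish. *)
  pose B := [set (- b)%R | b in subset_sums chi2 TH].
  have B0 : 0%R \in B.
    by apply/imsetP; exists 0%R; rewrite ?oppr0 ?subset_sums0.
  have cB : minn p (size TH).+1 <= #|B|.
    by rewrite card_imset; [apply: card_subset_sums | apply: oppr_inj].
  have cBC : #|B| + #|~: B| = p by rewrite cardsC card_Fp.
  have [|U [UT Un]] := @subseq_values_in _ p G _ _ [set 0%R] B TN D1 D2 F0 B0 TNG.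
    (* If [size TH < p], the cost is at most [2 * p - 2 - size TH], below [size TN]. If
       [size TH = p], then [B] is everything and the cost [p - 1] is still below [size TN = p]. *)
    rewrite C0; move: #|B| #|~: B| cB cBC => b b' cB cBC.
    by clear - cB cBC sTHN le_p p_gt1; lia.
  rewrite inE => U1 /imsetP [b /subset_sumsP [W WT Wb] U2].
  have sU := subseq_submset UT; have sW := subseq_submset WT.
  have GU := submset_all sU TNG; have GW := submset_all sW THG.
  exists (W ++ U); split; last first.
    case: U Un UT {sU GU U1 U2} => // x U _ UT; exists x.
      by rewrite mem_cat inE eqxx orbT.
    have: x \in TN by rewrite (mem_subseq UT) ?inE ?eqxx.
    by rewrite mem_filter => /andP [].
  split.
  - exact: submset_trans (submset_cat sW sU) pT.
  - by rewrite -nilpE /nilp size_cat addn_eq0 negb_and orbC size_eq0 Un.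
  have HW := submset_all sW HTH.
  rewrite big_cat /= kZ ?groupM ?prod_in_group //.
  rewrite D1 ?D2 ?prod_in_group // (eqP U1) addr0 k1 ?(prod_in_group GW) //.
  rewrite (prod_in_group HW) /= U2 -Wb (additive_on_prod D2 GW).
  by rewrite subrr.
(* Now [C ++ TH] has at least [(p - 2) + (p + 1) = 2 * p - 1] terms in [H]. On [H], [chi2] vanishes
   exactly on the center and [chi3] exactly on [<[a]>]; these subgroups meet trivially. *)
have sZH : 'Z(G) \subset H := center_sub_subcent1 Ga.
have aH : <[a]> \subset H by rewrite cycle_subG mem_subcent1.
have [||chi3 D3 k3] := @index_prime_additive _ p p_pr H <[a]>%G.
- by rewrite -sub_abelian_normal // abelian_subcent1.
- rewrite -divgS // card_subcent1 // -orderE order_noncentral //.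
  by rewrite expnS expn1 mulKn // prime_gt0.
have HCT : all (mem H) (C ++ TH).
  by rewrite all_cat HTH andbT; apply/allP=> x /(allP ZC)/(subsetP sZH).
have [|U [UT Un]] := @subseq_values_in _ p H _ _ _ _ (C ++ TH)
    (additive_onS sHG D2) D3 F0 F0 HCT.
  by rewrite C0 size_cat; clear - sC gt_p p_gt1; lia.
have sU := subseq_submset UT; have HU := submset_all sU HCT.
rewrite !inE => U2; rewrite k3 ?(prod_in_group HU) // => Ua.
apply: (@submset_product_one _ U) => //.
  apply: submset_trans sU (submset_cat _ _) => //.
  exact/subseq_submset/filter_subseq.
apply/set1gP; rewrite -(center_TI_cycle Ga nZa) inE Ua andbT.
have UG := subsetP sHG _ (prod_in_group HU).
by rewrite kZ // U2 andbT k1 // (prod_in_group HU).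
Qed.

(* The subset sums of [C] miss at most one element. *)
Lemma central_sub_prod_eq V W : central_sub V -> central_sub W ->
  has_product_one_subseq (C ++ T) \/ \prod_(x <- V) x = \prod_(x <- W) x.
Proof.
move=> cV cW; have p_gt1 := prime_gt1 p_pr; have [chi D k] := center_additive.
set A := subset_sums chi C.
have [AV|nAV] := boolP ((- chi (\prod_(x <- V) x)%g)%R \in A).
  by left; apply: central_sub_completion D k cV AV.
have [AW|nAW] := boolP ((- chi (\prod_(x <- W) x)%g)%R \in A).
  by left; apply: central_sub_completion D k cW AW.
right; have [_ _ ZV] := cV; have [_ _ ZW] := cW.
have cA : #|A| + #|~: A| = p by rewrite cardsC card_Fp.
have leA : p.-1 <= #|A|.
  by apply: leq_trans (card_central_subset_sums k); clear - sC p_gt1; lia.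
have /card_le1_eqP le1 : #|~: A| <= 1 by move: #|A| #|~: A| cA leA; clear; lia.
have /oppr_inj eVW : (- chi (\prod_(x <- V) x)%g = - chi (\prod_(x <- W) x)%g)%R.
  by apply: le1; rewrite inE.
apply/eqP; rewrite eq_sym eq_mulVg1 -k ?groupM ?groupV // D ?groupV // eVW.
by rewrite -D ?groupV // mulVg (additive_on1 D).
Qed.

(** Move [x] and another term [y] to the front in either order. Both products are central, hence
    equal unless a product-one subsequence exists, and cancelling the common tail gives
    [x * y = y * x]. *)
Lemma central_sub_subcent1 V x : central_sub V -> x \in V ->
  has_product_one_subseq (C ++ T) \/ all (mem 'C_G[x]) V.
Proof.
move=> [VT Vn ZV] Vx; have GV := submset_all VT GT.
case: (boolP (all _ _)) => [|/allPn [y Vy nCy]]; [by right | left].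
have [Gx Gy] : x \in G /\ y \in G by split; apply: (allP GV).
have nxy : y != x.
  by apply: contraNneq nCy => ->; rewrite /= inE Gx cent1id.
have pV : perm_eq V (x :: y :: rem y (rem x V)).
  apply: perm_trans (perm_to_rem Vx) _; rewrite perm_cons perm_to_rem //.
  by move: Vy; rewrite (perm_mem (perm_to_rem Vx)) inE (negPf nxy).
set R := rem y _ in pV.
have pV' : perm_eq V (y :: x :: R).
  by apply: perm_trans pV _; rewrite -(cat1s x) -(cat1s y) perm_catCA.
have cW W : perm_eq V W -> central_sub W.
  move=> pVW; split; last by rewrite -(prod_center_perm GV pVW).
    by apply: submset_trans VT; apply: perm_submset; rewrite perm_sym.
  by apply: contraNneq Vn => W0; apply/eqP/perm_nilP; rewrite -W0.
have [//|] := central_sub_prod_eq (cW _ pV) (cW _ pV').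
rewrite !big_cons !mulgA => /mulIg xy.
by case/negP: nCy; rewrite /= inE Gy; apply/cent1P.
Qed.

(** The concatenation [V ++ W] also has central product. If that equals the product of [W],
    cancellation makes the product of [V] trivial. *)
Lemma central_sub_disjoint V W : central_sub V -> central_sub W ->
    submset (V ++ W) T ->
  has_product_one_subseq (C ++ T).
Proof.
move=> cV cW sVW; have [VT Vn ZV] := cV; have [_ _ ZW] := cW.
have [|||eVW] := @central_sub_prod_eq (V ++ W) W; rewrite //.
  split=> //; last by rewrite big_cat groupM.
  by rewrite -nilpE /nilp size_cat addn_eq0 negb_and size_eq0 Vn.
apply: (@submset_product_one _ V) => //.
  by move=> x; rewrite count_cat (leq_trans (VT x)) ?leq_addl.
by apply: (mulIg (\prod_(x <- W) x)); rewrite mul1g -{2}eVW big_cat.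
Qed.

Lemma product_one_of_few_central : has_product_one_subseq (C ++ T).
Proof.
have [a Ga nZa] := Heisenberg_noncentral.
have [//|[V [cV [b Vb _]]]] := central_sub_off_subcent1 Ga nZa.
have VT : submset V T by case: cV.
have [Gb nZb] := (allP GT _ (submset_mem VT Vb), allP nZT _ (submset_mem VT Vb)).
have [//|CV] := central_sub_subcent1 cV Vb.
have [//|[W [cW [c Wc nCc]]]] := central_sub_off_subcent1 Gb nZb.
have [//|CW] := central_sub_subcent1 cW Wc.
have WT : submset W T by case: cW.
have Gc : c \in G := allP GT _ (submset_mem WT Wc).
(* [V] lies in the centralizer of [b] and [W] in that of [c], where [b] and [c] do not commute. A
   shared term would be central, which terms of [T] are not; so multiplicities never add up. *)
apply: (central_sub_disjoint cV cW) => x; rewrite count_cat.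
have [Vx|nVx] := boolP (x \in V); last first.
  by rewrite (count_memPn nVx) add0n; apply: WT.
have [Wx|nWx] := boolP (x \in W); last first.
  by rewrite (count_memPn nWx) addn0; apply: VT.
have /negP [] := allP nZT _ (submset_mem VT Vx).
apply: (subsetP (subcent1I_center Gb nZb Gc nCc)).
by rewrite inE; apply/andP; split; [apply: (allP CV) | apply: (allP CW)].
Qed.

End CentralAndNoncentralTerms.

End HeisenbergGroup.

(** * Case distinction on the number of central terms *)

Theorem theorem2p6 (gT : finGroupType) (G : {group gT}) (p : nat)
  (S : seq gT) :
  prime p -> odd p ->
  #|G| = p ^ 3 -> ~~ abelian G -> exponent G = p ->
  all (fun x => x \in G) S ->
  size S = 3 * p - 2 ->
  p - 2 <= count (fun x => x \in ('Z(G))%g) S ->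
  has_product_one_subseq S.
Proof.
move=> p_pr p_odd oG nabG expG GS sS leZ; have p_gt1 := prime_gt1 p_pr.
have [S1|nS1] := boolP (1%g \in S).
  apply: (@submset_product_one _ [:: 1%g]); rewrite ?big_seq1 //.
  by apply: subseq_submset; rewrite sub1seq.
pose C : seq gT := [seq x <- S | x \in 'Z(G)%g].
pose T : seq gT := [seq x <- S | x \notin 'Z(G)%g].
have pS : perm_eq (C ++ T) S by rewrite (perm_filterC (mem 'Z(G)%g)).
have sCT : size C + size T = 3 * p - 2 by rewrite -size_cat (perm_size pS).
have leC : p - 2 <= size C by rewrite size_filter.
have ZC : all (mem 'Z(G)%g) C := filter_all _ _.
have C1 : 1%g \notin C by rewrite mem_filter negb_and nS1 orbT.
have GCT : all (mem G) (C ++ T) by rewrite (perm_all _ pS).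
apply: has_product_one_subseq_submset (perm_submset pS) _.
have [le_p|gt_p] := leqP p.-1 (size C); last first.
  move: GCT; rewrite all_cat => /andP [_ GT].
  apply: (product_one_of_few_central p_pr oG nabG expG ZC C1 GT (filter_all _ _)).
    by clear - leC gt_p p_gt1; lia.
  by clear - sCT leC gt_p p_gt1; lia.
(* Keep exactly [p - 1] central terms; the surplus joins [T], leaving
   [(3 * p - 2) - (p - 1) = 2 * p - 1] terms in the second list. *)
rewrite -(cat_take_drop p.-1 C) -catA.
apply: (product_one_of_many_central p_pr oG nabG).
- by apply/allP=> x /mem_take; apply: (allP ZC).
- by apply: contra C1; apply: mem_take.
- by move: GCT; rewrite -{1}(cat_take_drop p.-1 C) -catA all_cat => /andP [].
- by rewrite size_takel.
by rewrite size_cat size_drop; clear - sCT le_p p_gt1; lia.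
Qed.
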